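(* Let $\{\Lambda_i\}_{i\in\mathbb{N}}$ be a countable system of closed cones in $\mathbb{R}^n$ that is extremal at the origin and satisfies the nonoverlapping condition $$\bigcap_{i=1}^{\infty}\Lambda_i=\{0\}.$$ Then there are $x_i^*\in N(0;\Lambda_i)$ for $i=1,2,\ldots$ such that $$\sum_{i=1}^{\infty}\frac{1}{2^i}x_i^*=0\quad\text{and}\quad\sum_{i=1}^{\infty}\frac{1}{2^i}\|x_i^*\|^2=1.$$ Moreover, one can find $w_i\in\Lambda_i$ for which $x_i^*\in\widehat N(w_i;\Lambda_i)$, $i=1,2,\ldots$.
   Context: $\mathbb{R}^n$ carries the Euclidean norm $\|\cdot\|$ and is identified with its dual; $\mathbb{N}=\{1,2,\ldots\}$. A cone is a set $\Lambda$ with $0\in\Lambda$ and $\lambda v\in\Lambda$ whenever $v\in\Lambda$, $\lambda\ge 0$; cones need not be convex. Extremality: a countable system of cones $\{\Lambda_i\}_{i\in\mathbb{N}}$ is extremal at the origin if there is a bounded sequence $\{a_i\}_{i\in\mathbb{N}}\subset\mathbb{R}^n$ with $\bigcap_{i=1}^\infty(\Lambda_i-a_i)=\emptyset$. For $\Omega\subset\mathbb{R}^n$, $\bar x\in\Omega$, $\varepsilon\ge 0$, the set of $\varepsilon$-normals is $$\widehat N_\varepsilon(\bar x;\Omega)=\Big\{x^*\Big|\ \limsup_{x\to\bar x,\,x\in\Omega,\,x\neq\bar x}\frac{\langle x^*,x-\bar x\rangle}{\|x-\bar x\|}\le\varepsilon\Big\}$$ (the condition being vacuous if $\bar x$ is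 isolated in $\Omega$), and $\widehat N(\bar x;\Omega):=\widehat N_0(\bar x;\Omega)$ is the Fréchet normal cone. The limiting normal cone $N(\bar x;\Omega)$ is the set of all $x^*$ for which there are sequences $\varepsilon_k\downarrow 0$, $x_k\to\bar x$ with $x_k\in\Omega$, and $x_k^*\to x^*$ with $x_k^*\in\widehat N_{\varepsilon_k}(x_k;\Omega)$ for all $k$. *)

(* Defs.v *)
From HB Require Import structures.
From mathcomp Require Import all_boot all_order all_algebra.
From mathcomp Require Import all_classical all_reals all_analysis.

Set Implicit Arguments.
Unset Strict Implicit.
Unset Printing Implicit Defensive.

Import Order.TTheory GRing.Theory Num.Theory.
Import numFieldNormedType.Exports.

Local Open Scope classical_set_scope.
Local Open Scope ring_scope.

(* The library's norm on 'rV[R]_n is the sup norm, so the Euclidean norm is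
   defined here; both norms induce the library's topology on 'rV[R]_n, which is
   the one used below for limits and closedness. *)
Definition edot (R : realType) (n : nat) (u v : 'rV[R]_n) : R :=
  \sum_(j < n) u 0 j * v 0 j.

Definition enorm (R : realType) (n : nat) (u : 'rV[R]_n) : R :=
  Num.sqrt (edot u u).

Definition is_cone (R : realType) (n : nat) (L : set 'rV[R]_n) : Prop :=
  L 0 /\ forall (v : 'rV[R]_n) (c : R), L v -> 0 <= c -> L (c *: v).

Definition extremal_at_origin (R : realType) (n : nat)
    (L : nat -> set 'rV[R]_n) : Prop :=
  exists a : nat -> 'rV[R]_n,
    (exists M : R, forall i, enorm (a i) <= M) /\
    \bigcap_(i in [set: nat]) [set v - a i | v in L i] = set0.

(* [xbar^'] is the filter of punctured neighborhoods.  If [xbar] is isolated in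
   [Omega], the filter contains the empty set and the upper limit is [-oo], so
   every vector is an eps-normal.  Membership of [xbar] in [Omega] is required
   where the definition is used. *)
Definition eps_normal (R : realType) (n : nat) (eps : R)
    (xbar : 'rV[R]_n) (Omega : set 'rV[R]_n) : set 'rV[R]_n :=
  [set xs | (limf_esup
       (fun x : 'rV[R]_n => (edot xs (x - xbar) / enorm (x - xbar))%:E)
       (within Omega xbar^') <= eps%:E)%E].

Definition frechet_normal (R : realType) (n : nat)
    (xbar : 'rV[R]_n) (Omega : set 'rV[R]_n) : set 'rV[R]_n :=
  eps_normal 0 xbar Omega.

Definition limiting_normal (R : realType) (n : nat)
    (xbar : 'rV[R]_n) (Omega : set 'rV[R]_n) : set 'rV[R]_n :=
  [set xs | exists (eps : nat -> R) (x y : nat -> 'rV[R]_n),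
    [/\ (forall k, 0 < eps k) /\ nonincreasing_seq eps,
        eps @ \oo --> (0 : R),
        (forall k, Omega (x k)) /\ x @ \oo --> xbar,
        y @ \oo --> xs &
        forall k, eps_normal (eps k) (x k) Omega (y k)]].

(* Main.v *)
(* Minimize F x = sum_i 2^-i dist(x + a_i, Lambda_i)^2.  Extremality makes F
   positive.  The same functional with zero shifts is homogeneous of degree 2
   and, by nonoverlapping, positive off the origin, so F is coercive and attains
   its minimum at some x.  If w_i is a projection of x + a_i on Lambda_i, then x
   also minimizes the quadratic function sum_i 2^-i ||y + a_i - w_i||^2 of y,
   whose stationarity reads sum_i 2^-i (x + a_i - w_i) = 0.  The vectors
   x + a_i - w_i are proximal normals, hence Frechet normals, at w_i; after
   division by sqrt (F x) they are the required x_i^*. *)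
Require Import Defs.
From HB Require Import structures.
From mathcomp Require Import all_boot all_order all_algebra.
From mathcomp Require Import all_classical all_reals all_analysis.
From mathcomp Require Import ring lra.

Set Implicit Arguments.
Unset Strict Implicit.
Unset Printing Implicit Defensive.

Import Order.TTheory GRing.Theory Num.Theory.
Import numFieldNormedType.Exports.

Local Open Scope classical_set_scope.
Local Open Scope ring_scope.

(** * Euclidean geometry: norm inequalities, attainment of minima, projections *)

Section Euclidean.
Variables (R : realType) (n : nat).
Implicit Types (u v w : 'rV[R]_n) (c : R).

Lemma edotC u v : edot u v = edot v u.
Proof. by apply: eq_bigr => j _; rewrite mulrC. Qed.

Lemma edotDl u v w : edot (u + v) w = edot u w + edot v w.
Proof. by rewrite -big_split; apply: eq_bigr => j _ /=; rewrite mxE mulrDl. Qed.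

Lemma edotZl c u v : edot (c *: u) v = c * edot u v.
Proof. by rewrite /edot mulr_sumr; apply: eq_bigr => j _; rewrite mxE mulrA. Qed.

Lemma edotNl u v : edot (- u) v = - edot u v.
Proof. by rewrite -scaleN1r edotZl mulN1r. Qed.

Lemma edotDr u v w : edot w (u + v) = edot w u + edot w v.
Proof. by rewrite !(edotC w) edotDl. Qed.

Lemma edotZr c u v : edot u (c *: v) = c * edot u v.
Proof. by rewrite !(edotC u) edotZl. Qed.

Lemma edotNr u v : edot u (- v) = - edot u v.
Proof. by rewrite !(edotC u) edotNl. Qed.

Lemma edot0r u : edot u 0 = 0.
Proof. by rewrite -(scale0r 0) edotZr mul0r. Qed.

Lemma edot_sumr u (I : Type) (r : seq I) (f : I -> 'rV[R]_n) :
  edot u (\sum_(i <- r) f i) = \sum_(i <- r) edot u (f i).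
Proof.
by elim/big_ind2 : _ => [|x1 y1 x2 y2 <- <-|//]; rewrite ?edot0r ?edotDr.
Qed.

Definition edotE := (edotDl, edotDr, edotNl, edotNr, edotZl, edotZr).

Lemma edot_ge0 u : 0 <= edot u u.
Proof. by apply: sumr_ge0 => j _; rewrite -expr2 sqr_ge0. Qed.

Lemma enorm_sqr u : enorm u ^+ 2 = edot u u.
Proof. by rewrite sqr_sqrtr ?edot_ge0. Qed.

Lemma enorm_ge0 u : 0 <= enorm u.
Proof. exact: sqrtr_ge0. Qed.

Lemma enormN u : enorm (- u) = enorm u.
Proof. by rewrite /enorm !edotE opprK. Qed.

Lemma enormBC u v : enorm (u - v) = enorm (v - u).
Proof. by rewrite -enormN opprB. Qed.

Lemma enormZ c u : enorm (c *: u) = `|c| * enorm u.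
Proof. by rewrite /enorm !edotE mulrA -expr2 sqrtrM ?sqr_ge0// sqrtr_sqr. Qed.

Lemma ler_enorm u v : (enorm u <= enorm v) = (edot u u <= edot v v).
Proof. by rewrite ler_sqrt// ?edot_ge0. Qed.

Lemma norm_le_enorm u : `|u| <= enorm u.
Proof.
rewrite [leLHS]/Num.norm /= mx_normrE; apply/bigmax_leP; split=> [|[i j] _ /=].
  exact: enorm_ge0.
rewrite -(ler_pXn2r (n := 2)) ?nnegrE ?enorm_ge0// enorm_sqr real_normK ?num_real//.
rewrite (ord1 i) /edot (bigD1 j)//= -expr2 lerDl.
by apply: sumr_ge0 => k _; rewrite -expr2 sqr_ge0.
Qed.

Lemma enorm_le_norm u : enorm u <= Num.sqrt n%:R * `|u|.
Proof.
rewrite -[`|u|]ger0_norm// -sqrtr_sqr -sqrtrM// ler_sqrt ?mulr_ge0 ?sqr_ge0//.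
rewrite mulr_natl -[X in _ *+ X]card_ord -sumr_const; apply: ler_sum => j _.
rewrite -expr2 -[u 0 j ^+ 2]real_normK ?num_real// ler_pXn2r ?nnegrE//.
rewrite [leRHS]/Num.norm /= mx_normrE.
exact: (le_bigmax_cond _ (fun ij : 'I_1 * 'I_n => `|u ij.1 ij.2|) (j := (0, j))).
Qed.

Lemma enorm_eq0 u : (enorm u == 0) = (u == 0).
Proof.
apply/idP/eqP => [/eqP u0|->]; last by rewrite /enorm edot0r sqrtr0.
by apply/eqP; rewrite -normr_eq0 eq_le normr_ge0 andbT -u0 norm_le_enorm.
Qed.

Lemma cauchy_schwarz u v : edot u v <= enorm u * enorm v.
Proof.
have [->|u0] := eqVneq u 0; first by rewrite edotC edot0r mulr_ge0 ?enorm_ge0.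
have [->|v0] := eqVneq v 0; first by rewrite edot0r mulr_ge0 ?enorm_ge0.
have a0 : 0 < enorm u by rewrite lt_def enorm_eq0 u0 enorm_ge0.
have b0 : 0 < enorm v by rewrite lt_def enorm_eq0 v0 enorm_ge0.
(* With [a], [b] the norms and [d] the inner product, this square expands to
   [2 * a * b * (a * b - d)], and [a * b] is positive. *)
have := edot_ge0 (enorm v *: u - enorm u *: v).
rewrite !edotE (edotC v u) -!enorm_sqr.
set a := enorm u in a0 *; set b := enorm v in b0 *; set d := edot u v => h.
rewrite -subr_ge0 -(pmulr_rge0 _ (mulr_gt0 a0 b0)); lra.
Qed.

Lemma ler_enormD u v : enorm (u + v) <= enorm u + enorm v.
Proof.
rewrite -(ler_pXn2r (n := 2)) ?nnegrE ?addr_ge0 ?enorm_ge0//.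
rewrite sqrrD !enorm_sqr !edotE (edotC v u).
by have := cauchy_schwarz u v; lra.
Qed.

Lemma enorm_cvg0 (x : 'rV[R]_n) (e : R) : 0 < e ->
  \forall y \near x, enorm (x - y) < e.
Proof.
move=> e0; have k0 : 0 < Num.sqrt n%:R + 1 :> R by rewrite ltr_wpDl ?sqrtr_ge0.
have /cvgrPdist_lt/(_ _ (divr_gt0 e0 k0)) : y @[y --> x] --> x by exact: cvg_id.
apply: filterS => y.
rewrite ltr_pdivlMr// mulrC => /(le_lt_trans _); apply.
rewrite (le_trans (enorm_le_norm _))// ler_wpM2r//; lra.
Qed.

Lemma locally_lipschitz_continuous (f : 'rV[R]_n -> R) :
  (forall x, exists K, forall y, enorm (x - y) <= 1 ->
     `|f x - f y| <= K * enorm (x - y)) -> continuous f.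
Proof.
move=> hf x; have [K hK] := hf x.
suff : f y @[y --> (x : 'rV[R]_n)] --> f x by [].
apply/(cvgrPdist_lt (FF := nbhs_filter (x : 'rV[R]_n))) => e e0.
have K0 : 0 < `|K| + 1 by rewrite ltr_wpDl.
have := @filterI _ _ (nbhs_filter x) _ _
  (enorm_cvg0 x ltr01) (enorm_cvg0 x (divr_gt0 e0 K0)).
apply: filterS => y /= [/ltW y1 yK].
rewrite (le_lt_trans (hK _ y1))// (@le_lt_trans _ _ ((`|K| + 1) * enorm (x - y)))//.
  by rewrite ler_wpM2r ?enorm_ge0//; have := ler_norm K; lra.
by rewrite mulrC -ltr_pdivlMr.
Qed.

Lemma ler_dist_enorm u v : `|enorm u - enorm v| <= enorm (u - v).
Proof.
have := ler_enormD (u - v) v; have := ler_enormD (v - u) u.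
rewrite !subrK (enormBC v u) ler_norml; lra.
Qed.

Lemma enorm_continuous : continuous (@enorm R n).
Proof.
apply: locally_lipschitz_continuous => x; exists 1 => y _.
by rewrite mul1r ler_dist_enorm.
Qed.

Lemma edot_continuous u : continuous (edot u).
Proof.
apply: locally_lipschitz_continuous => x; exists (enorm u) => y _.
rewrite -edotNr -edotDr ler_norml cauchy_schwarz andbT lerNl -edotNr opprB enormBC.
exact: cauchy_schwarz.
Qed.

(** The part of [A] where [f] is at most [f v] is closed and bounded, hence compact; the rest of [A]
    has values above [f v] and cannot do better. *)
Lemma closed_min (f : 'rV[R]_n -> R) (A : set 'rV[R]_n) (v : 'rV[R]_n) (r : R) :
  continuous f -> closed A -> A v ->
  (forall x, A x -> f x <= f v -> enorm x <= r) ->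
  exists2 p, A p & forall x, A x -> f p <= f x.
Proof.
move=> cf cA Av Ar; pose B := A `&` [set x | f x <= f v].
have cB : closed B.
  by apply: closedI => //; exact: (closed_comp (fun x _ => cf x) (@closed_le R (f v))).
have bB : bounded_set B.
  exists r; split; rewrite ?num_real// => s rs x [Ax fx].
  exact: le_trans (norm_le_enorm x) (le_trans (Ar _ Ax fx) (ltW rs)).
have [||p] := @EVT_min_rV R n f B _ (bounded_closed_compact bB cB).
- by exists v; split => /=.
- exact: continuous_subspaceT.
rewrite inE => -[Ap pv] pmin; exists p => // x Ax.
have [xv|/ltW vx] := leP (f x) (f v); last exact: le_trans vx.
by apply: pmin; rewrite inE; split.
Qed.

Lemma closed_projection (A : set 'rV[R]_n) : closed A -> A !=set0 ->
  exists P : 'rV[R]_n -> 'rV[R]_n,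
    forall x, A (P x) /\ forall v, A v -> enorm (x - P x) <= enorm (x - v).
Proof.
move=> cA [v Av].
have /choice[P hP] : forall x, exists p,
    A p /\ forall v, A v -> enorm (x - p) <= enorm (x - v).
  move=> x.
  (* The radius is the triangle inequality: a point no farther from [x] than [v] has norm at most
     [enorm (x - v) + enorm x]. *)
  have [|y Ay yx|p Ap pmin] := @closed_min (fun y => enorm (x - y)) A v
    (enorm (x - v) + enorm x) _ cA Av; [| |by exists p].
    apply: locally_lipschitz_continuous => y; exists 1 => z _.
    by rewrite mul1r (le_trans (ler_dist_enorm _ _))// opprB addrC subrKA enormBC.
  have := ler_enormD (y - x) x; rewrite subrK enormBC; lra.
by exists P.
Qed.

End Euclidean.

(** * Proximal normals and their behavior along the rays of a cone *)

Section ProximalNormals.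
Variables (R : realType) (n : nat).
Implicit Types (A : set 'rV[R]_n) (w x xs : 'rV[R]_n) (c t e : R).

(** The inequality is global in [A], not just near [w], so that it can be rescaled along rays. *)
Definition proximal_normal w A : set 'rV[R]_n :=
  [set xs | exists K : R, forall v, A v -> edot xs (v - w) <= K * edot (v - w) (v - w)].

(** The difference quotient is at most [K * enorm (x - w)], which vanishes as [x] tends to [w]. *)
Lemma proximal_eps_normal e w A xs :
  0 <= e -> proximal_normal w A xs -> eps_normal e w A xs.
Proof.
move=> e0 [K hK]; rewrite /eps_normal /=; apply/lee_addgt0Pr => d d0.
have K0 : 0 < `|K| + 1 by rewrite ltr_wpDl.
apply: ge_ereal_inf.
(* The upper limit is an infimum of suprema over neighborhoods; on the ball of this radius the
   quotient is at most [d]. The set may contain [w], where division by zero gives the value 0. *)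
exists (ereal_sup [set (edot xs (x - w) / enorm (x - w))%:E
    | x in [set x | A x /\ enorm (w - x) < d / (`|K| + 1)]]).
  eexists; last by [].
  have wd := enorm_cvg0 w (divr_gt0 d0 K0).
  by rewrite /within /= /dnbhs /within /=; apply: filterS wd => x /= xd _ Ax.
apply: ge_ereal_sup => _ [x [Ax xd] <-]; rewrite -EFinD lee_fin.
have [->|xw] := eqVneq (enorm (x - w)) 0.
  by rewrite invr0 mulr0 addr_ge0// ltW.
have {}xw : 0 < enorm (x - w) by rewrite lt_def xw enorm_ge0.
rewrite ler_pdivrMr// (le_trans (hK _ Ax))// -enorm_sqr expr2 mulrA.
rewrite ler_wpM2r ?enorm_ge0// (@le_trans _ _ d) ?lerDr//.
rewrite enormBC ltr_pdivlMr// mulrC in xd.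
rewrite (le_trans _ (ltW xd))// ler_wpM2r ?enorm_ge0//.
by have := ler_norm K; lra.
Qed.

(** Expanding the squared form of [wmin] gives [2 * edot (x - w) (v - w) <= edot (v - w) (v - w)],
    whence the constant [c / 2]. *)
Lemma projection_proximal_normal A x w c :
  A w -> (forall v, A v -> enorm (x - w) <= enorm (x - v)) -> 0 <= c ->
  proximal_normal w A (c *: (x - w)).
Proof.
move=> Aw wmin c0; exists (c / 2) => v /wmin; rewrite ler_enorm.
have -> : x - v = (x - w) - (v - w) by rewrite opprB addrA subrK.
move: (x - w) (v - w) => a b; rewrite !edotE (edotC b a) => h.
rewrite -mulrA ler_wpM2l//; lra.
Qed.

(** The two sides have degrees 1 and 2 in [v - w], so testing at [t^-1 *: v] and scaling back turns
    [K] into [K / t]. *)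
Lemma cone_proximal_normalZ A w xs t :
  is_cone A -> 0 < t -> proximal_normal w A xs -> proximal_normal (t *: w) A xs.
Proof.
move=> [_ Acone] t0 [K hK]; exists (K / t) => v Av.
have {1 2 3}-> : v = t *: (t^-1 *: v) by rewrite scalerA mulfV ?gt_eqF ?scale1r.
rewrite -scalerBr !(edotZl, edotZr).
have := hK _ (Acone _ t^-1 Av _); rewrite invr_ge0 => /(_ (ltW t0)).
set p := edot xs _; set q := edot _ _ => pq.
by rewrite (_ : K / t * _ = t * (K * q)) ?ler_pM2l//; field; rewrite gt_eqF.
Qed.

(* Normals are invariant along rays, so a normal at [w] is one at [w / k]. *)
Lemma cone_proximal_limiting_normal A w xs :
  is_cone A -> A w -> proximal_normal w A xs -> limiting_normal 0 A xs.
Proof.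
move=> hA Aw wxs; exists (@harmonic R), (fun k => harmonic k *: w), (fun=> xs).
split.
- split=> [k|i j ij]; first exact: harmonic_gt0.
  by rewrite /= lef_pV2 ?posrE ?ltr0n// ler_nat.
- exact: cvg_harmonic.
- split=> [k|]; first by apply: hA.2 => //; exact: harmonic_ge0.
  by rewrite -[X in _ --> X](scale0r w); apply: cvgZr_tmp; exact: cvg_harmonic.
- exact: cvg_cst.
- move=> k; apply: proximal_eps_normal; first exact: harmonic_ge0.
  by apply: cone_proximal_normalZ => //; exact: harmonic_gt0.
Qed.

End ProximalNormals.

(* The library does not register row vectors as a complete normed module. *)
HB.instance Definition _ (R : realType) (n : nat) := Complete.on 'rV[R]_n.

(** * Series with weights [1 / 2 ^+ i.+1], which sum to 1 *)

Section WeightedSums.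
Variable R : realType.
Implicit Types (u v : nat -> R) (c : R).

(** [limn] is informative only for a convergent series; boundedness of [u] ensures convergence. *)
Definition wsum u : R := limn (series (fun i => 1 / 2 ^+ i.+1 * u i)).

Definition bounded_seq u := exists M, forall i, `|u i| <= M.

Lemma bounded_seq_cst c : bounded_seq (fun=> c).
Proof. by exists `|c|. Qed.

Lemma bounded_seqD u v :
  bounded_seq u -> bounded_seq v -> bounded_seq (fun i => u i + v i).
Proof.
move=> [M uM] [N vN]; exists (M + N) => i.
by rewrite (le_trans (ler_normD _ _))// lerD.
Qed.

Lemma bounded_seqZ c u : bounded_seq u -> bounded_seq (fun i => c * u i).
Proof. by move=> [M uM]; exists (`|c| * M) => i; rewrite normrM ler_wpM2l. Qed.

Lemma weight_gt0 i : 0 < 1 / 2 ^+ i.+1 :> R.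
Proof. by rewrite divr_gt0 ?exprn_gt0. Qed.

Lemma weight_ge0 i : 0 <= 1 / 2 ^+ i.+1 :> R.
Proof. exact/ltW/weight_gt0. Qed.

Lemma cvg_weights c : series (fun i => 1 / 2 ^+ i.+1 * c) @ \oo --> c.
Proof.
have := @cvg_geometric_series_half R c 0; rewrite expr0 divr1.
by under eq_fun do rewrite addn1 natrX -[c / _]mulr1 mulrAC -mulrA mulrC mul1r -div1r.
Qed.

Lemma wsum_cst c : wsum (fun=> c) = c.
Proof. by apply/cvg_lim => //; exact: cvg_weights. Qed.

(** Absolute convergence by domination by a geometric series; the general [V] serves both real and
    vector series. *)
Lemma norm_cvg_weighted (V : completeNormedModType R) (s : nat -> V) (M : R) :
  (forall i, `|s i| <= M) ->
  cvgn (series (fun i => (1 / 2 ^+ i.+1 : R) *: s i)).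
Proof.
move=> sM; apply: normed_cvg.
have M0 : 0 <= M by rewrite (le_trans _ (sM 0%N)).
apply: (@series_le_cvg _ _ (fun i => 1 / 2 ^+ i.+1 * M)) => [i|i|i|].
- exact: normr_ge0.
- by rewrite mulr_ge0 ?weight_ge0.
- by rewrite /= normrZ gtr0_norm ?weight_gt0// ler_pM2l ?weight_gt0.
- by apply/cvg_ex; exists M; exact: cvg_weights.
Qed.

Lemma wsum_cvg u : bounded_seq u ->
  series (fun i => 1 / 2 ^+ i.+1 * u i) @ \oo --> wsum u.
Proof. by move=> [M uM]; exact: (@norm_cvg_weighted R^o u M uM). Qed.

Lemma wsumD u v : bounded_seq u ->
  bounded_seq v -> wsum (fun i => u i + v i) = wsum u + wsum v.
Proof.
move=> /wsum_cvg uM /wsum_cvg vM; apply/cvg_lim => //.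
rewrite (_ : series _ = series (fun i => 1 / 2 ^+ i.+1 * u i) +
  series (fun i => 1 / 2 ^+ i.+1 * v i)); first exact: cvgD.
by rewrite -seriesD; congr series; apply/funext => i; rewrite mulrDr.
Qed.

Lemma wsumZ c u : bounded_seq u ->
  wsum (fun i => c * u i) = c * wsum u.
Proof.
move=> /wsum_cvg uM; apply/cvg_lim => //.
rewrite (_ : series _ = c *: series (fun i => 1 / 2 ^+ i.+1 * u i)).
  exact: cvgZl_tmp.
by rewrite -seriesZ; congr series; apply/funext => i; rewrite mulrCA.
Qed.

Lemma ler_wsum u v : bounded_seq u ->
  bounded_seq v -> (forall i, u i <= v i) -> wsum u <= wsum v.
Proof.
move=> /wsum_cvg/cvgP uM /wsum_cvg/cvgP vM uv; apply: lim_series_le => // i.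
by rewrite ler_pM2l ?weight_gt0.
Qed.

Lemma wsum_gt0 u i : bounded_seq u ->
  (forall i, 0 <= u i) -> 0 < u i -> 0 < wsum u.
Proof.
move=> /wsum_cvg/cvgP uM u0 ui.
have w0 k : 0 <= 1 / 2 ^+ k.+1 * u k by rewrite mulr_ge0 ?weight_ge0.
apply: lt_le_trans (nondecreasing_cvgn_le _ uM i.+1).
  rewrite seriesSr /= ltr_wpDl ?sumr_ge0 ?mulr_gt0 ?weight_gt0//.
exact: nondecreasing_series.
Qed.

End WeightedSums.

(** * The weighted sum of squared distances and its minimizers *)

Section DistanceFunctional.
Variables (R : realType) (n : nat) (L : nat -> set 'rV[R]_n).
Variable P : nat -> 'rV[R]_n -> 'rV[R]_n.
Hypothesis hcone : forall i, is_cone (L i).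
Hypothesis hP : forall i x,
  L i (P i x) /\ forall v, L i v -> enorm (x - P i x) <= enorm (x - v).
Implicit Types (x y : 'rV[R]_n) (a : nat -> 'rV[R]_n) (M : R).

(** By [hP], the distance from [x] to [L i]. *)
Let d i x := enorm (x - P i x).

Let d_ge0 i x : 0 <= d i x.
Proof. exact: enorm_ge0. Qed.

Let d_lip i x y : d i x <= d i y + enorm (x - y).
Proof.
rewrite (le_trans ((hP i x).2 _ (hP i y).1))// [leRHS]addrC.
by have := ler_enormD (x - y) (y - P i y); rewrite addrA subrK.
Qed.

Let d_le i x : d i x <= enorm x.
Proof. by have := (hP i x).2 _ (hcone i).1; rewrite subr0. Qed.

Definition sqdist_sum a x := wsum (fun i => d i (x + a i) ^+ 2).

Let d_bounded a M x : (forall i, enorm (a i) <= M) ->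
  forall i, d i (x + a i) <= enorm x + M.
Proof.
by move=> aM i; rewrite (le_trans (d_le _ _))// (le_trans (ler_enormD _ _))// lerD2l.
Qed.

Lemma bounded_sqdist a M x : (forall i, enorm (a i) <= M) ->
  bounded_seq (fun i => d i (x + a i) ^+ 2).
Proof.
move=> aM; exists ((enorm x + M) ^+ 2) => i.
rewrite ger0_norm ?sqr_ge0// ler_pXn2r ?nnegrE ?d_ge0 ?d_bounded//.
exact: le_trans (d_ge0 i (x + a i)) (d_bounded _ aM _).
Qed.

(** Termwise, [s ^+ 2 - t ^+ 2] factors as [(s - t) * (s + t)]: the distance is 1-Lipschitz, and
    [d_bounded] bounds [s + t]. *)
Lemma sqdist_sum_lip a M x y : (forall i, enorm (a i) <= M) ->
  sqdist_sum a x - sqdist_sum a y <= (enorm x + enorm y + 2 * M) * enorm (x - y).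
Proof.
move=> aM; rewrite lerBlDl -[X in _ <= _ + X]wsum_cst.
have bc := bounded_seq_cst ((enorm x + enorm y + 2 * M) * enorm (x - y)).
have bx := bounded_sqdist x aM; have b_y := bounded_sqdist y aM.
rewrite -wsumD//; apply: ler_wsum => // [|i]; first exact: bounded_seqD.
rewrite -lerBlDl subr_sqr.
have := d_bounded x aM i; have := d_bounded y aM i.
have := d_lip i (x + a i) (y + a i); rewrite opprD addrACA subrr addr0.
move: (d_ge0 i (x + a i)) (d_ge0 i (y + a i)) (enorm_ge0 (x - y)).
set s := d _ _; set t := d _ _ => s0 t0 e0 st yM xM; rewrite mulrC.
have st0 : 0 <= s + t by rewrite addr_ge0.
rewrite (@le_trans _ _ ((s + t) * enorm (x - y)))//.
  by rewrite ler_wpM2l//; lra.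
by rewrite ler_wpM2r//; lra.
Qed.

Lemma sqdist_sum_continuous a M : (forall i, enorm (a i) <= M) ->
  continuous (sqdist_sum a).
Proof.
move=> aM; apply: locally_lipschitz_continuous => x.
exists (2 * enorm x + 1 + 2 * M) => y xy1.
have yx : enorm y <= enorm x + 1.
  by have := ler_enormD x (y - x); rewrite addrC subrK enormBC; lra.
have e0 := enorm_ge0 (x - y).
have := sqdist_sum_lip x y aM; have := sqdist_sum_lip y x aM.
rewrite (enormBC y x) => h1 h2.
have h3 : (enorm x + enorm y + 2 * M) * enorm (x - y) <=
  (2 * enorm x + 1 + 2 * M) * enorm (x - y) by rewrite ler_wpM2r//; lra.
rewrite ler_norml; lra.
Qed.

(** Serves twice: with the given shifts for extremality, with zero shifts for nonoverlapping. *)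
Lemma sqdist_sum_gt0 a M x : (forall i, enorm (a i) <= M) ->
  ~ (forall i, L i (x + a i)) -> 0 < sqdist_sum a x.
Proof.
move=> aM /existsNP[i Li].
apply: (@wsum_gt0 _ _ i) => [|k|]; first exact: bounded_sqdist aM.
  exact: sqr_ge0.
rewrite exprn_even_gt0//= enorm_eq0 subr_eq0; apply: contra_notN Li => /eqP ->.
exact: (hP _ _).1.
Qed.

Let zero_le0 (i : nat) : enorm (0 : 'rV[R]_n) <= 0.
Proof. by rewrite le_eqVlt enorm_eq0 eqxx. Qed.

(** The point [c *: P i x] stays in the cone [L i] and competes with the projection of [c *: x]. *)
Lemma sqdist_sum0_homogeneous x c : 0 < c ->
  sqdist_sum (fun=> 0) (c *: x) <= c ^+ 2 * sqdist_sum (fun=> 0) x.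
Proof.
move=> c0; have bd y := bounded_sqdist y zero_le0.
rewrite -wsumZ//; apply: ler_wsum => // [|i]; first exact: bounded_seqZ.
rewrite -exprMn !addr0 ler_pXn2r ?nnegrE ?mulr_ge0 ?d_ge0 ?(ltW c0)//.
rewrite -[c in c * _]gtr0_norm// -enormZ scalerBr.
by apply: (hP _ _).2; apply: (hcone _).2; [exact: (hP _ _).1 | exact: ltW].
Qed.

(** Removing the shift changes each distance by at most [M], and
    [(t + M) ^+ 2 <= 2 * t ^+ 2 + 2 * M ^+ 2]. *)
Lemma sqdist_sum0_le a M x : (forall i, enorm (a i) <= M) ->
  sqdist_sum (fun=> 0) x <= 2 * sqdist_sum a x + 2 * M ^+ 2.
Proof.
move=> aM; have bx := bounded_sqdist x aM.
rewrite -[2 * M ^+ 2]wsum_cst -wsumZ// -wsumD; last 2 first.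
- exact: bounded_seqZ.
- exact: bounded_seq_cst.
apply: ler_wsum => [||i].
- exact: (bounded_sqdist x zero_le0).
- by apply: bounded_seqD; [exact: bounded_seqZ | exact: bounded_seq_cst].
- rewrite addr0; have := d_lip i x (x + a i).
  rewrite opprD addNKr enormN; have := aM i.
  move: (d_ge0 i x) (d_ge0 i (x + a i)) (enorm_ge0 (a i)).
  set s := d _ _; set t := d _ _ => s0 t0 e0 eM st.
  have : s ^+ 2 <= (t + M) ^+ 2.
    by rewrite ler_pXn2r ?nnegrE//; lra.
  have := sqr_ge0 (t - M); rewrite sqrrB sqrrD; lra.
Qed.

(* The functional with zero shifts has a positive minimum on the unit sphere,
   hence by homogeneity it dominates a multiple of the squared norm. *)
Lemma sqdist_sum0_coercive : \bigcap_(i in [set: nat]) L i = [set 0] ->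
  exists2 c, 0 < c & forall x, c * enorm x ^+ 2 <= sqdist_sum (fun=> 0) x.
Proof.
move=> capL.
have G_ge0 x : 0 <= sqdist_sum (fun=> 0) x.
  rewrite -[0 in leLHS](wsum_cst (0 : R)); apply: ler_wsum => [||i].
  - exact: bounded_seq_cst.
  - exact: bounded_sqdist zero_le0.
  - exact: sqr_ge0.
have x0P x : x != 0 -> 0 < enorm x by move=> x0; rewrite lt_def enorm_eq0 x0 enorm_ge0.
have unit x : x != 0 -> enorm ((enorm x)^-1 *: x) = 1.
  move=> x0; rewrite enormZ gtr0_norm ?invr_gt0 ?x0P// mulVf// gt_eqF//; exact: x0P.
(* The unit sphere is empty when [n = 0]; then every [x] is 0 and any [c] works. *)
have [[v v1]|nov] := pselect (exists v : 'rV[R]_n, enorm v = 1); last first.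
  exists 1 => // x; have [->|x0] := eqVneq x 0.
    by rewrite (eqP (_ : enorm 0 == 0)) ?enorm_eq0// expr0n mulr0.
  by exfalso; apply: nov; exists ((enorm x)^-1 *: x); exact: unit.
have cS : closed [set u : 'rV[R]_n | enorm u = 1].
  exact: (closed_comp (fun u _ => enorm_continuous (x := u)) (@closed_eq R 1)).
have [x /= -> //|p /= p1 pmin] :=
  closed_min (r := 1) (sqdist_sum_continuous zero_le0) cS v1.
have p0 : p != 0 by rewrite -enorm_eq0 p1 oner_eq0.
exists (sqdist_sum (fun=> 0) p).
  apply: sqdist_sum_gt0 zero_le0 _ => Lp; move/negP : p0; apply; apply/eqP.
  have : (\bigcap_(i in [set: nat]) L i) p by move=> i _; rewrite -[p]addr0.
  by rewrite capL.
move=> x; have [->|x0] := eqVneq x 0.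
  by rewrite (eqP (_ : enorm 0 == 0)) ?enorm_eq0// expr0n mulr0.
have := sqdist_sum0_homogeneous x (_ : 0 < (enorm x)^-1).
rewrite invr_gt0 => /(_ (x0P _ x0)) /(le_trans (pmin _ (unit _ x0))).
by rewrite exprVn mulrC ler_pdivlMr ?exprn_gt0 ?x0P.
Qed.

Lemma sqdist_sum_min a M : (forall i, enorm (a i) <= M) ->
  \bigcap_(i in [set: nat]) L i = [set 0] ->
  exists x, forall y, sqdist_sum a x <= sqdist_sum a y.
Proof.
move=> aM /sqdist_sum0_coercive[c c0 hc].
(* If the value at [x] is at most that at 0, coercivity and [sqdist_sum0_le] bound [enorm x ^+ 2] by
   the quotient; the [+ 1] comes from [enorm x <= enorm x ^+ 2 + 1]. *)
have [x _ xy|x _ xmin] := @closed_min _ _ (sqdist_sum a) setT 0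
  ((2 * sqdist_sum a 0 + 2 * M ^+ 2) / c + 1) (sqdist_sum_continuous aM) closedT I;
  last by exists x => y; exact: xmin.
have : enorm x ^+ 2 <= (2 * sqdist_sum a 0 + 2 * M ^+ 2) / c.
  rewrite ler_pdivlMr// mulrC (le_trans (hc x))// (le_trans (sqdist_sum0_le x aM))//.
  by rewrite lerD2r ler_pM2l.
have := sqr_ge0 (enorm x - 1); rewrite sqrrB expr1n; have := enorm_ge0 x; lra.
Qed.

(* At a minimizer [x] the squared distances may be replaced by the squared norms
   of [y + a i - P i (x + a i)], which only increases the functional for [y != x];
   the step [y = x - S], with [S] the weighted sum below, would then decrease
   it by at least [enorm S ^+ 2]. *)
Lemma sqdist_sum_min_stationary a M x : (forall i, enorm (a i) <= M) ->
  (forall y, sqdist_sum a x <= sqdist_sum a y) ->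
  series (fun i => (1 / 2 ^+ i.+1) *: (x + a i - P i (x + a i))) @ \oo -->
    (0 : 'rV[R]_n).
Proof.
move=> aM xmin; set s := fun i => x + a i - P i (x + a i).
have sM i : enorm (s i) <= enorm x + M by exact: d_bounded.
have : cvgn (series (fun i => (1 / 2 ^+ i.+1 : R) *: s i)).
  by apply: (@norm_cvg_weighted R 'rV[R]_n s (enorm x + M)) => i;
    rewrite (le_trans (norm_le_enorm _)).
move=> /cvg_ex[S cvS]; suff <- : S = 0 by exact: cvS.
have bS : bounded_seq (fun i => edot S (s i)).
  exists (enorm S * (enorm x + M)) => i.
  rewrite ler_norml (le_trans (cauchy_schwarz _ _)) ?ler_wpM2l ?enorm_ge0//.
  rewrite lerNl -edotNl (le_trans (cauchy_schwarz _ _))// enormN.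
  by rewrite ler_wpM2l ?enorm_ge0.
(* Continuity of [edot S] carries the inner product through the vector series. *)
have eS : wsum (fun i => edot S (s i)) = edot S S.
  apply/cvg_lim => //.
  have eE : series (fun i => 1 / 2 ^+ i.+1 * edot S (s i)) =
      edot S \o series (fun i => (1 / 2 ^+ i.+1 : R) *: s i).
    apply/funext => k; rewrite /series /= edot_sumr.
    by apply: eq_bigr => i _; rewrite edotZr.
  by rewrite eE; apply: continuous_cvg => //; exact: edot_continuous.
have bs := bounded_sqdist x aM.
have bc := bounded_seq_cst (edot S S); have b2 := bounded_seqZ (- 2) bS.
have b3 := bounded_seqD b2 bc.
have : sqdist_sum a (x - S) <=
    wsum (fun i => d i (x + a i) ^+ 2 + (- 2 * edot S (s i) + edot S S)).
  apply: ler_wsum => [||i].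
  - exact: bounded_sqdist aM.
  - exact: bounded_seqD.
  - have : d i (x - S + a i) <= enorm (s i - S).
      have -> : s i - S = x - S + a i - P i (x + a i).
        by rewrite /s addrAC (addrAC x).
      by apply: (hP _ _).2; exact: (hP _ _).1.
    rewrite -(ler_pXn2r (n := 2)) ?nnegrE ?d_ge0 ?enorm_ge0// => /le_trans; apply.
    rewrite !enorm_sqr -/(s i); move: (s i) => z; rewrite !edotE (edotC z S); lra.
rewrite !wsumD// wsumZ// wsum_cst eS.
move=> /(le_trans (xmin _)); rewrite -/(sqdist_sum a x) -enorm_sqr => h.
apply/eqP; rewrite -enorm_eq0 -sqrf_eq0 eq_le sqr_ge0 andbT; lra.
Qed.

End DistanceFunctional.

(* The index i : nat stands for the index i + 1 of the systems indexed by
   {1, 2, ...}, whence the weights 1 / 2 ^ (i + 1). *)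
Theorem theorem4p2 (R : realType) (n : nat) (L : nat -> set 'rV[R]_n)
    (hcone : forall i, is_cone (L i))
    (hclosed : forall i, closed (L i))
    (hext : extremal_at_origin L)
    (hnonoverlap : \bigcap_(i in [set: nat]) L i = [set 0]) :
  exists xs : nat -> 'rV[R]_n,
    [/\ forall i, limiting_normal 0 (L i) (xs i),
        series (fun i => (1 / 2 ^+ i.+1) *: xs i) @ \oo --> (0 : 'rV[R]_n),
        series (fun i => 1 / 2 ^+ i.+1 * enorm (xs i) ^+ 2) @ \oo --> (1 : R) &
        exists w : nat -> 'rV[R]_n,
          forall i, L i (w i) /\ frechet_normal (w i) (L i) (xs i)].
Proof.
have [a [[M aM] ext]] := hext.
have /choice[P hP] : forall i, exists Pi : 'rV[R]_n -> 'rV[R]_n, forall x,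
    L i (Pi x) /\ forall v, L i v -> enorm (x - Pi x) <= enorm (x - v).
  by move=> i; apply: closed_projection => //; exists 0; exact: (hcone i).1.
have [x xmin] := sqdist_sum_min hcone hP aM hnonoverlap.
have stat := sqdist_sum_min_stationary hcone hP aM xmin.
(* If every [x + a i] were in [L i], then [x] would lie in all the shifted cones, against
   extremality. *)
have F0 : 0 < sqdist_sum P a x.
  apply: (sqdist_sum_gt0 hcone hP aM) => Lx.
  suff : (set0 : set 'rV[R]_n) x by [].
  by rewrite -ext => i _; exists (x + a i) => //; rewrite addrK.
(* Chosen so that [c ^+ 2 * sqdist_sum P a x = 1], the second required sum. *)
pose c := (Num.sqrt (sqdist_sum P a x))^-1.
pose w i := P i (x + a i).
have c_ge0 : 0 <= c by rewrite invr_ge0 sqrtr_ge0.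
have prox i : proximal_normal (w i) (L i) (c *: (x + a i - w i)).
  by apply: projection_proximal_normal => //; have [] := hP i (x + a i).
have Lw i : L i (w i) by have [] := hP i (x + a i).
exists (fun i => c *: (x + a i - w i)); split.
- by move=> i; apply: (cone_proximal_limiting_normal (hcone i) (Lw i)).
- rewrite -(scaler0 _ c) (_ : series _ =
    c *: series (fun i => (1 / 2 ^+ i.+1 : R) *: (x + a i - w i))).
    exact: cvgZl_tmp.
  rewrite -seriesZ; congr series; apply/funext => i /=.
  by rewrite -[RHS]/(_ *: (_ *: _)) !scalerA mulrC.
- have /wsum_cvg cvF := bounded_sqdist hcone hP x aM.
  rewrite (_ : series _ = c ^+ 2 *: series (fun i =>
    1 / 2 ^+ i.+1 * enorm (x + a i - w i) ^+ 2)).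
    rewrite -[X in _ --> X](_ : c ^+ 2 *: sqdist_sum P a x = 1); first exact: cvgZl_tmp.
    by rewrite /c exprVn sqr_sqrtr ?ltW// -[_ *: _]/(_ * _) mulVf// gt_eqF.
  rewrite -seriesZ; congr series; apply/funext => i /=.
  by rewrite enormZ exprMn real_normK ?num_real// mulrCA.
- exists w => i; split; first exact: Lw.
  exact: proximal_eps_normal.
Qed.
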